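(* Let $\mathcal{H}$ be a simplicial hyperplane arrangement in $\mathbb{R}^n$ with $\bigcap\mathcal{H}=\{0\}$, and let $\mathcal{A}$ be a subspace arrangement embedded in $\mathcal{H}$ which consists of hyperplanes. Then the simplicial complex $\Delta_{\mathcal{A},\mathcal{H}}$ is shellable.
   Context: A hyperplane arrangement $\mathcal{H}$ in $\mathbb{R}^n$ is a finite set of linear hyperplanes. If $\bigcap\mathcal{H}=\{0\}$, then $\mathcal{H}$ determines a regular cell decomposition $\Delta_\mathcal{H}$ of the unit sphere $S^{n-1}$: after choosing an orientation of each hyperplane, each point $p\in S^{n-1}$ gets a sign vector in $\{0,-,+\}^{\mathcal{H}}$ recording whether $p$ lies on, on the negative side of, or on the positive side of each $h\in\mathcal{H}$; the cells are the sets of points with a common sign vector. $\mathcal{H}$ is called simplicial if $\Delta_\mathcal{H}$ is a simplicial complex. The intersection lattice $L_\mathcal{H}$ is the set of all intersections of subfamilies of $\mathcal{H}$, ordered by reverse inclusion. A subspace arrangement $\mathcal{A}$ (a finite set of linear subspaces none containing another) is embedded in $\mathcal{H}$ if $\mathcal{A}$ is an antichain in $L_\mathcal{H}$. In that case $(\bigcup\mathcal{A})\cap S^{n-1}$ is a union of cells of $\Delta_\mathcal{H}$ and hence a simplicial subcomplex of $\Delta_\mathcal{H}$; this subcomplex is denoted $\Delta_{\mathcal{A},\mathcal{H}}$. A pure simplicial complex of dimension $d-1$ is shellable if its facets admit a total order $F_1,\dots,F_t$ such that $F_j\cap(\bigcup_{i<j}F_i)$ is pure of dimension $d-2$ for all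 $j=2,\dots,t$. *)

(* Defs.v *)
From HB Require Import structures.
From mathcomp Require Import all_boot all_order all_algebra finmap.
From mathcomp Require Import boolp classical_sets functions cardinality.
From mathcomp Require Import reals topology normedtype.

Set Implicit Arguments.
Unset Strict Implicit.
Unset Printing Implicit Defensive.

Import Order.TTheory GRing.Theory Num.Theory.
Import numFieldNormedType.Exports.

Local Open Scope classical_set_scope.
Local Open Scope ring_scope.

(** * Abstract simplicial complexes and shellability *)

Section SimplicialComplexes.
Variable T : choiceType.
Implicit Types (K : set {fset T}) (F G : {fset T}).

(* The empty face, of dimension -1, always belongs to the complex. *)
Definition simplicial_complex K : Prop :=
  [/\ finite_set K, K fset0 & forall F G, K F -> (G `<=` F)%fset -> K G].

Definition face_dim F : int := #|` F|%:Z - 1.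

Definition facet K F : Prop :=
  K F /\ forall G, K G -> (F `<=` G)%fset -> G = F.

Definition pure_of_dim K (m : int) : Prop :=
  forall F, facet K F -> face_dim F = m.

Definition simplex F : set {fset T} := [set G | (G `<=` F)%fset].

(* The facets are listed as F_0, ..., F_(t-1), so that "j = 2, ..., t" becomes
   0 < j < t. *)
Definition shellable K : Prop :=
  simplicial_complex K /\
  exists d : nat, pure_of_dim K (d%:Z - 1) /\
    exists s : seq {fset T},
      [/\ uniq s,
          forall F, F \in s <-> facet K F
        & forall j : nat, (0 < j < size s)%N ->
            pure_of_dim
              (simplex (nth fset0 s j) `&`
               \bigcup_(i < j) simplex (nth fset0 s i))
              (d%:Z - 2)].

End SimplicialComplexes.

(** * Cell complexes, given by the set of their (relatively open) cells *)

Section CellComplexes.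
Variable V : topologicalType.
Implicit Types (P : set (set V)) (C D : set V).

(* The 0-cells, which are singletons, in the closure of C. *)
Definition vertex_set P C : set V := [set v | P [set v] /\ closure C v].

Definition vertex_scheme P : set {fset V} :=
  [set F | F = fset0 \/ exists2 C, P C & [set` F] = vertex_set P C].

(* The regular cell complex P is a simplicial complex: sending a cell to its
   set of vertices is an isomorphism from the poset of cells, ordered by
   C <= D iff C is contained in the closure of D, onto the poset of nonempty
   faces of an abstract simplicial complex. (That C <= D implies inclusion of
   the vertex sets is automatic.) *)
Definition is_simplicial P : Prop :=
  [/\ forall C, P C -> finite_set (vertex_set P C) /\ vertex_set P C !=set0,
      forall C D, P C -> P D ->
        vertex_set P C `<=` vertex_set P D -> C `<=` closure D,
      forall C D, P C -> P D -> vertex_set P C = vertex_set P D -> C = D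
    & simplicial_complex (vertex_scheme P)].

End CellComplexes.

(** * Arrangements in R^n *)

Section Arrangements.
Variables (R : realType) (n : nat).
Local Notation V := ('rV[R]_n).
Implicit Types (H A : {fset {vspace V}}) (U W : {vspace V}).

Definition dot (u v : V) : R := \sum_(i < n) u ord0 i * v ord0 i.

(* The Euclidean sphere (the library norm on matrices is the sup norm). *)
Definition sphere : set V := [set p | dot p p = 1].

(* Stated with a successor so that there is no hyperplane when n = 0. *)
Definition is_hyperplane U : Prop := (\dim U).+1 = n.

Definition hyperplane_arrangement H : Prop :=
  forall h, h \in H -> is_hyperplane h.

Definition intersection H : {vspace V} := (\bigcap_(h <- H) h)%VS.

Definition intersection_lattice H : set {vspace V} :=
  [set U | exists2 S : {fset {vspace V}}, (S `<=` H)%fset & U = intersection S].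

Definition subspace_arrangement A : Prop :=
  forall U W, U \in A -> W \in A -> (U <= W)%VS -> U = W.

(* An antichain for inclusion is the same as one for reverse inclusion. *)
Definition embedded A H : Prop :=
  (forall U, U \in A -> intersection_lattice H U) /\
  (forall U W, U \in A -> W \in A -> (W <= U)%VS -> U = W).

(* An orientation of h is a normal vector of h; the positive side of h is the
   open half-space into which it points. *)
Definition is_orientation H (a : H -> V) : Prop :=
  forall (h : H) (x : V), x \in fsval h <-> dot (a h) x = 0.

Definition sign_vector H (a : H -> V) (p : V) : {ffun H -> int} :=
  [ffun h => sgz (dot (a h) p)].

Definition cells H (a : H -> V) : set (set V) :=
  [set C | exists2 p, sphere p &
     C = [set q | sphere q /\ sign_vector a q = sign_vector a p]].

Definition simplicial_arrangement H (a : H -> V) : Prop :=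
  is_simplicial (cells a).

Definition union_of A : set V := [set x | exists2 U, U \in A & x \in U].

(* The subcomplex of the cell complex of H carried by the union of A, as an
   abstract simplicial complex on its set of vertices. *)
Definition Delta A H (a : H -> V) : set {fset V} :=
  vertex_scheme [set C | cells a C /\ C `<=` union_of A].

End Arrangements.

(* Main.v *)
Require Import Defs.
From HB Require Import structures.
From mathcomp Require Import all_boot all_order all_algebra finmap.
From mathcomp Require Import boolp classical_sets functions cardinality.
From mathcomp Require Import reals topology normedtype realfun.

Set Implicit Arguments.
Unset Strict Implicit.
Unset Printing Implicit Defensive.

Import Order.TTheory GRing.Theory Num.Theory.
Import numFieldNormedType.Exports.

Local Open Scope classical_set_scope.
Local Open Scope ring_scope.

(** The sign vectors of the points of R^n are the covectors of an oriented
    matroid, and by simpliciality the faces below a covector correspond to the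
    subsets of its vertex set.  The facets of Delta are the ridges: covectors
    vanishing on exactly one hyperplane, which belongs to A.  Number the
    hyperplanes of A; those before h cut h into regions, and in each region fix
    a base ridge.  List the ridges of the first hyperplane, then those of the
    second, and so on, and inside one hyperplane by increasing number of
    hyperplanes on which a ridge agrees with the base ridge of its region, that
    is, the farthest from the base first.

    Suppose a face W of a ridge X of h lies in an earlier ridge.  Then some
    hyperplane other than h contains W and does not separate X from its base:
    otherwise X would be the ridge of its region farthest from the base among
    those containing W, and W would lie on no earlier hyperplane of A.  Walking
    from X away from the base inside the star of W, one leaves X through a wall
    U containing W, all of whose hyperplanes have this property.  Either U lies
    on an earlier hyperplane of A, or the reflection of X in U is a ridge of
    the same region that agrees less with the base; in both cases U lies in an
    earlier ridge.  Purity holds because reflection in a wall preserves the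
    number of vertices. *)

(** * Covectors *)

Section Covectors.
Variable E : finType.
Local Notation covector := {ffun E -> int}.
Implicit Types (X Y Z W : covector) (L : set covector).

Definition cov_zero : covector := [ffun=> 0].
Definition cov_opp X : covector := [ffun e => - X e].
Definition cov_comp X Y : covector := [ffun e => if X e == 0 then Y e else X e].
Definition cov_sep X Y : {set E} := [set e | (X e != 0) && (Y e == - X e)].
Definition cov_face X Y : Prop := forall e, X e != 0 -> X e = Y e.

(* The covector axioms of an oriented matroid. *)
Record covectors L : Prop := Covectors {
  cov_sign : forall X e, L X -> sgz (X e) = X e;
  cov_L0 : L cov_zero;
  cov_LN : forall X, L X -> L (cov_opp X);
  cov_LC : forall X Y, L X -> L Y -> L (cov_comp X Y);
  cov_elim : forall X Y e, L X -> L Y -> e \in cov_sep X Y ->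
    exists Z, [/\ L Z, Z e = 0 &
      forall f, f \notin cov_sep X Y -> Z f = cov_comp X Y f] }.

Lemma cov_face_trans X Y Z : cov_face X Y -> cov_face Y Z -> cov_face X Z.
Proof. by move=> XY YZ e X0; rewrite (XY e X0) YZ // -XY. Qed.

Lemma cov_face_anti X Y : cov_face X Y -> cov_face Y X -> X = Y.
Proof.
move=> XY YX; apply/ffunP => e.
have [X0|/XY //] := eqVneq (X e) 0.
by have [->//|/YX //] := eqVneq (Y e) 0.
Qed.

Lemma cov_face0 X : cov_face cov_zero X.
Proof. by move=> e; rewrite ffunE eqxx. Qed.

Lemma cov_face_comp X Y : cov_face X (cov_comp X Y).
Proof. by move=> e X0; rewrite ffunE (negbTE X0). Qed.

Lemma cov_face_zero X Y e : cov_face X Y -> Y e = 0 -> X e = 0.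
Proof. by move=> XY Y0; apply/eqP/negP => /negP X0; move: (X0); rewrite XY // Y0. Qed.

Variable L : set covector.
Hypothesis covL : covectors L.

Lemma cov_cases X e : L X -> [\/ X e = 0, X e = 1 | X e = -1].
Proof.
move=> /(cov_sign covL e); case: sgzP => _ <-; [by constructor 1|by constructor 2|by constructor 3].
Qed.

Lemma finite_covectors : finite_set L.
Proof.
pose f (x : {ffun E -> bool * bool}) : covector :=
  [ffun e => (x e).1%:Z - (x e).2%:Z].
apply: (@sub_finite_set _ _ (f @` setT)); last exact/finite_image/finite_finset.
move=> X LX; exists [ffun e => (X e == 1, X e == -1)] => //.
by apply/ffunP => e; rewrite !ffunE /=; case: (cov_cases e LX) => ->.
Qed.

Lemma cov_sepPn X Y e : L X -> L Y -> e \notin cov_sep X Y ->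
  [\/ X e = 0, Y e = 0 | Y e = X e].
Proof.
move=> LX LY; rewrite inE.
case: (cov_cases e LX) => ->; case: (cov_cases e LY) => -> //= _;
  by [constructor 1|constructor 2|constructor 3].
Qed.

(** Repeated elimination: each step replaces [Y] by a covector separated from [X] by strictly fewer
    elements, until none is left. *)
Lemma cov_conformal_elim X Y : L X -> L Y -> cov_sep X Y != finset.set0 ->
  exists Z, [/\ L Z,
    forall f, f \notin cov_sep X Y -> Z f = cov_comp X Y f,
    forall f, f \in cov_sep X Y -> Z f = 0 \/ Z f = X f &
    exists2 f, f \in cov_sep X Y & Z f = 0].
Proof.
move=> LX; have [m] := ubnP #|cov_sep X Y|; elim: m Y => // m IH Y ltm LY.
case/set0Pn => e eXY; have [Z [LZ Ze ZXY]] := cov_elim covL LX LY eXY.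
have sub : cov_sep X Z \subset cov_sep X Y :\ e.
  apply/fintype.subsetP => f fXZ; rewrite !inE; apply/andP; split.
    apply: contraTneq fXZ => ->; rewrite inE Ze.
    by case: (cov_cases e LX) => ->.
  have : f \in cov_sep X Y.
    apply: contraTT (fXZ) => fXY; rewrite inE ZXY // ffunE.
    by case: (cov_cases f LX) => ->.
  by rewrite inE.
have [XZ0|XZn0] := eqVneq (cov_sep X Z) finset.set0.
  exists Z; split=> //; last by exists e.
  move=> f; rewrite inE => /andP[Xf _].
  have : f \notin cov_sep X Z by rewrite XZ0 inE.
  by move/(cov_sepPn LX LZ) => [X0|->|->]; [rewrite X0 in Xf|left|right].
have [|Z' [LZ' Z'n Z'i [f fXZ Z'f]]] := IH Z _ LZ XZn0.
  apply: leq_ltn_trans (subset_leq_card sub) _.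
  by move: ltm; rewrite (cardsD1 e (cov_sep X Y)) eXY add1n !ltnS.
have sub' g : g \in cov_sep X Z -> g \in cov_sep X Y.
  by move/(fintype.subsetP sub); rewrite finset.in_setD1 => /andP[].
exists Z'; split=> //; last by exists f => //; exact: sub'.
- move=> g gXY; rewrite Z'n; last by apply: contra gXY; exact: sub'.
  by rewrite [LHS]ffunE ZXY // !ffunE; case: (X g == 0).
- move=> g gXY; have [/Z'i //|gXZ] := boolP (g \in cov_sep X Z).
  right; rewrite Z'n // ffunE; move: gXY; rewrite inE.
  by case: (eqVneq (X g) 0).
Qed.

(* Walking from [X] towards [Y] inside the star of [W], one first leaves [X]
   through a face whose supporting hyperplanes all separate [X] from [Y]. *)
Lemma cov_exit_face X Y W e : L X -> L Y -> L W -> cov_face W X ->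
    (forall f, X f = 0 -> Y f = 0) -> (forall f, Y f = 0 -> X f = 0) ->
    W e = 0 -> e \in cov_sep X Y ->
  exists Z, [/\ L Z, cov_face W Z, cov_face Z X, Z <> X &
    forall f, Z f = 0 -> X f <> 0 -> W f = 0 /\ Y f = - X f].
Proof.
(* [D] is [Y] pulled into the star of [W]: it is separated from [X] exactly by those separators of
   [X] and [Y] where [W] vanishes. *)
move=> LX LY LW WX XY YX We eXY; set D := cov_comp W Y.
have LD : L D by exact: cov_LC.
have sepD f : (f \in cov_sep X D) = (W f == 0) && (f \in cov_sep X Y).
  rewrite !inE ffunE; case: (eqVneq (W f) 0) => //= Wf.
  by rewrite -(WX f Wf) Wf /=; case: (cov_cases f LW) Wf => ->.
have [|Z [LZ Zn Zi [f0 f0D Zf0]]] := @cov_conformal_elim X D LX LD.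
  by apply/set0Pn; exists e; rewrite sepD We eqxx.
have ZX f : f \notin cov_sep X D -> Z f = X f.
  move=> fD; rewrite Zn // !ffunE; case: (eqVneq (X f) 0) => // Xf.
  by rewrite XY // (cov_face_zero WX Xf) eqxx.
exists Z; split=> //.
- move=> f Wf; rewrite ZX; first exact: WX.
  by rewrite sepD (negbTE Wf).
- move=> f; have [/Zi [->|->//]|/ZX ->//] := boolP (f \in cov_sep X D).
  by rewrite eqxx.
- move=> ZX'; move: f0D; rewrite inE -{1}ZX' Zf0 eqxx //.
- move=> f Zf Xf; have : f \in cov_sep X D.
    by apply: contra_notT Xf => /ZX <-.
  by rewrite sepD !inE => /andP[/eqP-> /andP[_ /eqP->]].
Qed.

(** Composition keeps the nonzero entries of its first factor, so witnesses for single elements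
    accumulate. *)
Lemma cov_generic (Q : set covector) (r : seq E) :
  Q cov_zero -> (forall X Y, Q X -> Q Y -> Q (cov_comp X Y)) ->
  (forall e, e \in r -> exists2 X, Q X & X e != 0) ->
  exists2 X, Q X & forall e, e \in r -> X e != 0.
Proof.
move=> Q0 QC; elim: r => [|e r IH] Qr; first by exists cov_zero.
have [X QX Xr] : exists2 X, Q X & forall e, e \in r -> X e != 0.
  by apply: IH => f fr; apply: Qr; rewrite inE fr orbT.
have [Y QY Ye] := Qr e (mem_head _ _).
exists (cov_comp X Y); first exact: QC.
move=> f; rewrite inE ffunE => /predU1P[->|/Xr Xf]; last by rewrite (negbTE Xf).
by case: ifP => // ->.
Qed.

End Covectors.

(** * Shelling the ridges of a simplicial oriented matroid *)

Section SimplicialCovectors.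
Variables (E : finType) (T : choiceType).
Local Notation covector := {ffun E -> int}.
Implicit Types (X Y Z W U B C : covector) (e f g : E).

Variables (L : set covector) (vert : covector -> {fset T}).
Hypothesis covL : covectors L.
Hypothesis vert_face : forall X Y, L X -> L Y ->
  (vert X `<=` vert Y)%fset <-> cov_face X Y.
Hypothesis vert_sub : forall X (S : {fset T}), L X -> (S `<=` vert X)%fset ->
  exists2 Y, L Y & vert Y = S.

Lemma vert_inj X Y : L X -> L Y -> vert X = vert Y -> X = Y.
Proof.
by move=> LX LY XY; apply: cov_face_anti; apply/vert_face => //; rewrite XY.
Qed.

Lemma vert_zero : vert (cov_zero E) = fset0.
Proof.
have L0 := cov_L0 covL; have [Y LY Y0] := vert_sub L0 (fsub0set _).
rewrite -Y0; congr vert; apply: cov_face_anti; first exact: cov_face0.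
by apply/vert_face => //; rewrite Y0 fsub0set.
Qed.

Lemma vert_ltn X Y : L X -> L Y -> cov_face X Y -> X <> Y ->
  (#|` vert X| < #|` vert Y|)%N.
Proof.
move=> LX LY XY neq; apply: fproper_ltn_card.
rewrite fproperEneq; apply/andP; split; last exact/vert_face.
by apply/eqP => /(vert_inj LX LY).
Qed.

Lemma card_wall X U v : v \in vert X -> vert U = (vert X `\ v)%fset ->
  #|` vert X| = #|` vert U|.+1.
Proof. by move=> vX ->; rewrite (cardfsD1 v (vert X)) vX add1n. Qed.

(** Drop a vertex of [X] that is not in [Z]: by simpliciality the remaining vertices span a face,
    and it still contains [Z]. *)
Lemma exists_wall X Z : L X -> L Z -> cov_face Z X -> Z <> X ->
  exists U v, [/\ L U, cov_face Z U, cov_face U X, v \in vert X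
    & vert U = (vert X `\ v)%fset].
Proof.
move=> LX LZ ZX neq; have subZX : (vert Z `<=` vert X)%fset by apply/vert_face.
have /fsubsetPn[v vX vZ] : ~~ (vert X `<=` vert Z)%fset.
  by apply/negP => /vert_face XZ; apply: neq; apply: cov_face_anti => //; exact: XZ.
have [U LU UX] := @vert_sub X (vert X `\ v)%fset LX (fsubD1set _ _).
exists U, v; split=> //; apply/vert_face => //; rewrite UX ?fsubD1set //.
by rewrite fsubsetD1 subZX.
Qed.

(* A proper face strictly between [U] and the mirror image of [X] would be
   reflected by [U] to one strictly between [U] and [X]. *)
Lemma card_reflect X U v : L X -> L U -> v \in vert X ->
    vert U = (vert X `\ v)%fset ->
  #|` vert (cov_comp U (cov_opp X))| = #|` vert X|.
Proof.
move=> LX LU vX UXv; set X' := cov_comp U (cov_opp X).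
have cX := card_wall vX UXv.
have UX : cov_face U X by apply/vert_face => //; rewrite UXv fsubD1set.
have LX' : L X' by apply: (cov_LC covL) => //; exact: cov_LN.
have UX' : cov_face U X' := @cov_face_comp _ _ _.
have neq : U <> X'.
  move=> eqU; have : U = X.
    apply: cov_face_anti => // e X0.
    have [Ue|/UX //] := eqVneq (U e) 0.
    by move: (Ue); rewrite eqU !ffunE Ue eqxx => /eqP; rewrite oppr_eq0 (negbTE X0).
  by move=> UX1; move: cX; rewrite UX1 => /n_Sn.
apply/eqP; rewrite eqn_leq; apply/andP; split; last by rewrite cX vert_ltn.
rewrite leqNgt; apply/negP => lt.
have [W [w [LW UW WX' wX' WX'w]]] := exists_wall LX' LU UX' neq.
have cX' := card_wall wX' WX'w.
have WU : W <> U by move=> WU; move: lt; rewrite cX' cX WU ltnn.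
have WX'n : W <> X' by move=> eqW; move: cX'; rewrite -eqW => /n_Sn.
set Y := cov_comp U (cov_opp W).
have LY : L Y by apply: (cov_LC covL) => //; exact: cov_LN.
have Yn0 e : U e = 0 -> Y e = - W e by move=> Ue; rewrite !ffunE Ue eqxx.
have X'n0 e : U e = 0 -> X' e = - X e by move=> Ue; rewrite !ffunE Ue eqxx.
have YX : cov_face Y X.
  move=> e; have [Ue|Ue] := eqVneq (U e) 0.
    by rewrite Yn0 // oppr_eq0 => /WX' ->; rewrite X'n0 // opprK.
  by move=> _; rewrite ffunE (negbTE Ue) UX.
have lt1 : (#|` vert U| < #|` vert Y|)%N.
  apply: vert_ltn => //; first exact: cov_face_comp.
  move=> eqY; apply: WU; apply: cov_face_anti => // e We.
  have [Ue|/UW //] := eqVneq (U e) 0.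
  by move/ffunP/(_ e): eqY; rewrite Yn0 // Ue => /esym/eqP; rewrite oppr_eq0 (negbTE We).
have lt2 : (#|` vert Y| < #|` vert X|)%N.
  apply: vert_ltn => // eqY; apply: WX'n; apply/ffunP => e.
  have [Ue|Ue] := eqVneq (U e) 0.
    by rewrite X'n0 // -eqY Yn0 // opprK.
  by rewrite -UW // UX'.
by rewrite cX ltnS in lt2; move: (leq_trans lt1 lt2); rewrite ltnn.
Qed.

(** * Chambers, ridges and their numbers of vertices *)

Hypothesis nonloop : forall e, exists2 X, L X & X e != 0.
Hypothesis nonparallel : forall e f, e != f ->
  exists X, [/\ L X, X e = 0 & X f != 0].

Definition chamber X := L X /\ forall e, X e != 0.
Definition ridge e X := L X /\ forall f, (X f == 0) = (f == e).

Lemma exists_chamber : exists X, chamber X.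
Proof.
have [|X LX X0] := @cov_generic E L (enum E) (cov_L0 covL) (cov_LC covL).
  by move=> e _; exact: nonloop.
by exists X; split => // e; rewrite X0 ?mem_enum.
Qed.

Lemma exists_ridge e : exists X, ridge e X.
Proof.
pose Q := [set X | L X /\ X e = 0].
have [|||X [LX Xe] X0] := @cov_generic E Q (enum (predC1 e)).
- by split; [exact: cov_L0|rewrite ffunE].
- move=> X Y [LX Xe] [LY Ye]; split; first exact: cov_LC.
  by rewrite ffunE Xe eqxx.
- move=> f; rewrite mem_enum inE eq_sym => /nonparallel [X [LX Xe Xf]].
  by exists X.
exists X; split => // f; have [->|fe] := eqVneq f e; first by rewrite Xe eqxx.
by apply/negbTE/X0; rewrite mem_enum.
Qed.

Lemma ridge_comp e X Y : L X -> X e = 0 -> ridge e Y -> ridge e (cov_comp X Y).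
Proof.
move=> LX Xe [LY Ye]; split; first exact: cov_LC.
move=> f; rewrite ffunE; have [//|Xf] := eqVneq (X f) 0.
by rewrite (negbTE Xf); apply/esym/negbTE; apply: contra Xf => /eqP ->; rewrite Xe.
Qed.

Lemma ridge_maximal e X Y : ridge e X -> cov_face X Y -> Y e = 0 -> Y = X.
Proof.
move=> [_ X0] XY Ye; apply/esym/cov_face_anti => // g.
have [->|ge _] := eqVneq g e; first by rewrite Ye eqxx.
by rewrite -XY // X0.
Qed.

(** A gallery from [X] to [Y]: reflecting [X] in a wall towards [Y] keeps the number of vertices and
    lowers the number of separating elements. *)
Lemma card_chamber X Y : chamber X -> chamber Y -> #|` vert X| = #|` vert Y|.
Proof.
have [m] := ubnP #|cov_sep X Y|; elim: m X => // m IH X ltm [LX X0] [LY Y0].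
have [XY0|/set0Pn [e eXY]] := eqVneq (cov_sep X Y) finset.set0.
  congr (#|` vert _|); apply/ffunP => e.
  have /(cov_sepPn covL LX LY) : e \notin cov_sep X Y by rewrite XY0 inE.
  by move: (X0 e) (Y0 e) => /eqP ? /eqP ?; case.
have [|||Z [LZ _ ZX ZnX Zsep]] := cov_exit_face covL LX LY (cov_L0 covL)
    (cov_face0 X) _ _ _ eXY.
- by move=> f /eqP; rewrite (negbTE (X0 f)).
- by move=> f /eqP; rewrite (negbTE (Y0 f)).
- by rewrite ffunE.
have [U [v [LU ZU UX vX UXv]]] := exists_wall LX LZ ZX ZnX.
rewrite -(card_reflect LX LU vX UXv).
have LX' : L (cov_comp U (cov_opp X)) by apply: (cov_LC covL) => //; exact: cov_LN.
apply: IH => //; last first.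
  by split=> // f; rewrite !ffunE; case: (eqVneq (U f) 0); rewrite ?oppr_eq0.
have Usep f : U f = 0 -> Y f = - X f.
  move=> Uf; case: (Zsep f) => //; first exact: cov_face_zero ZU Uf.
  exact/eqP/X0.
have [f Uf] : exists f, U f = 0.
  apply: contrapT => nU.
  have : U = X.
    by apply/ffunP => f; apply: UX; apply/eqP => Uf; apply: nU; exists f.
  by move=> eqU; move: (card_wall vX UXv); rewrite eqU => /n_Sn.
apply: leq_trans (_ : (#|cov_sep X Y| <= m)%N); last by rewrite -ltnS.
apply/proper_card/properP; split.
  apply/fintype.subsetP => g; rewrite !inE !ffunE.
  have [Ug|Ug] := eqVneq (U g) 0; last by rewrite UX.
  by rewrite Usep // X0 eqxx.
exists f; first by rewrite inE X0 Usep //=.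
rewrite inE !ffunE Uf eqxx Usep // opprK negb_and; apply/orP; right.
by case: (cov_cases covL f LX) (X0 f) => ->.
Qed.

(** The chamber [cov_comp X C] has [X] as a wall, hence one vertex more, and all chambers have
    equally many vertices. *)
Lemma card_ridge e X C : ridge e X -> chamber C -> #|` vert C| = #|` vert X|.+1.
Proof.
move=> rX cC; have [LC C0] := cC; have [LX X0] := rX.
pose D := cov_comp X C.
have cD : chamber D.
  by split=> [|f]; [exact: cov_LC|rewrite ffunE; case: (eqVneq (X f) 0)].
have LD : L D by case: cD.
have XD : cov_face X D by exact: cov_face_comp.
have neq : X <> D.
  move=> eqX; case: cD => _ /(_ e); rewrite -eqX.
  by rewrite X0 eqxx.
have [U [v [LU XU UD vD UDv]]] := exists_wall LD LX XD neq.
have cardD := card_wall vD UDv.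
rewrite (card_chamber cC cD) cardD; congr (#|` vert _|.+1).
apply: (ridge_maximal rX XU).
apply/eqP; apply: contraT => Ue; suff eqU : U = D.
  by move: cardD; rewrite eqU => /n_Sn.
apply/ffunP => f; apply: UD; have [->//|fe] := eqVneq f e.
by rewrite -XU // X0.
Qed.

(** * The shelling order *)

Variable A : {set E}.

Let rk e : nat := enum_rank e.

Lemma rk_inj : injective rk.
Proof. by move=> e f /ord_inj/enum_rank_inj. Qed.

(* [X] and [B] are ridges of the same hyperplane [e], lying on the same side of
   every hyperplane of [A] that precedes [e]. *)
Definition same_region X B := [/\ L B, forall f, (B f == 0) = (X f == 0)
  & forall e f, X e = 0 -> f \in A -> (rk f < rk e)%N -> B f = X f].

(** The choice is made from a set that ridges of one region share, so they get the same base. *)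
Definition base X := xget (cov_zero E) [set B | same_region X B].

Definition agreement X : {set E} := [set f | X f == base X f].

(** The lexicographic order as a number in base [#|E|.+1], which exceeds the size of any
    [agreement]. On a ridge the sum has a single term, the rank of its hyperplane. *)
Definition shelling_key X : nat :=
  (\sum_(e | X e == 0) rk e) * #|E|.+1 + #|agreement X|.

Lemma base_region X : L X -> same_region X (base X).
Proof. by move=> LX; apply: (@xgetPex _ _ [set B | same_region X B]); exists X. Qed.

Lemma base_eq e X Y : ridge e X -> ridge e Y ->
  (forall f, f \in A -> (rk f < rk e)%N -> X f = Y f) -> base X = base Y.
Proof.
move=> [LX X0] [LY Y0] XY; rewrite /base; congr (xget _ _).
apply/seteqP; split=> B /= [LB B0 Be]; (split=> //; [move=> f|move=> f g]).
- by rewrite B0 X0 Y0.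
- move=> /eqP; rewrite Y0 => /eqP -> gA lt; rewrite (Be e) //; first exact: XY.
  by apply/eqP; rewrite X0.
- by rewrite B0 X0 Y0.
- move=> /eqP; rewrite X0 => /eqP -> gA lt; rewrite (Be e) //; first exact/esym/XY.
  by apply/eqP; rewrite Y0.
Qed.

Lemma shelling_key_ridge e X : ridge e X ->
  shelling_key X = (rk e * #|E|.+1 + #|agreement X|)%N.
Proof. by move=> [_ X0]; rewrite /shelling_key (eq_bigl _ _ X0) big_pred1_eq. Qed.

Lemma shelling_key_ltn e f X Y : ridge e X -> ridge f Y -> (rk e < rk f)%N ->
  (shelling_key X < shelling_key Y)%N.
Proof.
move=> /shelling_key_ridge -> /shelling_key_ridge -> ef.
apply: (@leq_trans ((rk e).+1 * #|E|.+1)%N).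
  by rewrite mulSn addnC ltn_add2r ltnS max_card.
by apply: leq_trans (leq_addr _ _); rewrite leq_mul2r ef orbT.
Qed.

(** Applied to a facet [W] of the intersection with the earlier ridges, this forces [W = U]. [X']
    may tie with [X], as sorting breaks ties arbitrarily; [Y] comes earlier in any case. *)
Lemma shelling_step e e' X X' W : e \in A -> e' \in A ->
    ridge e X -> ridge e' X' -> X' <> X ->
    (shelling_key X' <= shelling_key X)%N ->
    L W -> cov_face W X -> cov_face W X' ->
  exists U v f Y, [/\ L U, cov_face W U,
    v \in vert X /\ vert U = (vert X `\ v)%fset,
    f \in A /\ ridge f Y & cov_face U Y /\ (shelling_key Y < shelling_key X)%N].
Proof.
move=> eA e'A rX rX' neq key LW WX WX'.
have [LX X0] := rX; have [LX' X'0] := rX'.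
have Xe : X e = 0 by apply/eqP; rewrite X0.
have [LB B0 Bs] := base_region LX; set B := base X in LB B0 Bs.
(* Such a [g] lets [X] move away from its base inside the star of [W]. If [X'] lies on an earlier
   hyperplane, take that one; on the same hyperplane, the lack of such a [g] would force
   [X' = X]. *)
have [g [Wg ge Bg]] : exists g, [/\ W g = 0, g != e & B g = X g].
  have [ltee'|lee'|/rk_inj eqe] := ltngtP (rk e) (rk e').
  - by move: key; rewrite leqNgt (shelling_key_ltn rX rX').
  - exists e'; split; first by apply: (cov_face_zero WX'); apply/eqP; rewrite X'0.
      by apply: contraTneq lee' => ->; rewrite ltnn.
    exact: (Bs e).
  rewrite -eqe in rX' X'0; apply: contrapT => nex; apply: neq.
  have WB g : W g = 0 -> g != e -> B g != X g.
    by move=> Wg ge; apply/eqP => Bg; apply: nex; exists g.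
  have eqA f : f \in A -> (rk f < rk e)%N -> X' f = X f.
    move=> fA lt; have [Wf|Wf] := eqVneq (W f) 0; last by rewrite -WX // WX'.
    have fe : f != e by apply: contraTneq lt => ->; rewrite ltnn.
    by move: (WB f Wf fe); rewrite (Bs e) // eqxx.
  have bX' : base X' = B by apply: (base_eq rX' rX).
  (* Where [X] agrees with [B], either [f = e] or [W] is nonzero and fixes [X'] too; the key bounds
     the cardinals the other way. *)
  have agr : agreement X = agreement X'.
    apply/eqP; rewrite eqEcard; apply/andP; split.
      apply/fintype.subsetP => f; rewrite !inE bX' -/B => /eqP XB.
      have [->|fe] := eqVneq f e.
        have /eqP -> : X' e == 0 by rewrite X'0.
        by rewrite eq_sym B0 X0.
      have [Wf|Wf] := eqVneq (W f) 0; last by rewrite -XB -WX // WX'.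
      by move: (WB f Wf fe); rewrite XB eqxx.
    by move: key; rewrite (shelling_key_ridge rX) (shelling_key_ridge rX') leq_add2l.
  apply/ffunP => f; have [->|fe] := eqVneq f e.
    by rewrite Xe; apply/eqP; rewrite X'0.
  have [Wf|Wf] := eqVneq (W f) 0; last by rewrite -WX // WX'.
  have := WB f Wf fe; have := B0 f; have := X0 f; have := X'0 f.
  move/finset.setP: agr => /(_ f); rewrite !inE bX' -/B (negbTE fe).
  by case: (cov_cases covL f LX) => ->; case: (cov_cases covL f LB) => ->;
    case: (cov_cases covL f LX') => ->.
(* The target is the opposite of [B], which [g] separates from [X], so the walk leads away from the
   base. *)
have [|||Z [LZ WZ ZX ZnX Zs]] :=
    @cov_exit_face _ _ covL X (cov_opp B) W g LX (cov_LN covL LB) LW WX _ _ Wg.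
- by move=> f /eqP; rewrite -B0 ffunE => /eqP ->; rewrite oppr0.
- by move=> f /eqP; rewrite ffunE oppr_eq0 B0 => /eqP.
- by rewrite inE X0 ge ffunE Bg eqxx.
have [U [v [LU ZU UX vX UXv]]] := exists_wall LX LZ ZX ZnX.
have UB f : U f = 0 -> X f != 0 -> B f = X f.
  move=> Uf /eqP Xf; have [_] := Zs f (cov_face_zero ZU Uf) Xf.
  by rewrite ffunE => /oppr_inj.
have WU : cov_face W U := cov_face_trans WZ ZU.
(* Either [U] lies on an earlier hyperplane of [A], and any ridge there through [U] serves, or
   reflection in [U] stays in the region of [X]. *)
have [[f [fA lt Uf]]|nf] :=
    pselect (exists f, [/\ f \in A, (rk f < rk e)%N & U f = 0]).
  have [Y rY] := exists_ridge f.
  have rUY := ridge_comp LU Uf rY.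
  exists U, v, f, (cov_comp U Y); split=> //; split; first exact: cov_face_comp.
  exact: shelling_key_ltn rUY rX lt.
pose Y := cov_comp U (cov_opp X).
have rY : ridge e Y.
  apply: ridge_comp => //; first exact: cov_face_zero UX Xe.
  by split=> [|f]; [exact: cov_LN|rewrite ffunE oppr_eq0].
exists U, v, e, Y; split=> //; split; first exact: cov_face_comp.
have bY : base Y = B.
  apply: (base_eq rY rX) => f fA lt.
  have Uf : U f != 0 by apply/eqP => Uf; apply: nf; exists f.
  by rewrite ffunE (negbTE Uf) UX.
rewrite (shelling_key_ridge rX) (shelling_key_ridge rY) ltn_add2l.
have [f Uf Xf] : exists2 f, U f = 0 & X f != 0.
  apply: contrapT => nU; have : U = X.
    apply: cov_face_anti => // f Xf; apply/esym/UX/eqP => Uf.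
    by apply: nU; exists f.
  by move=> eqU; move: (card_wall vX UXv); rewrite eqU => /n_Sn.
(* The reflection reverses exactly the entries where [U] vanishes; those other than [e] agreed with
   [B] before and no longer do. *)
apply/proper_card/properP; split.
  apply/fintype.subsetP => h; rewrite !inE bY -/B.
  have [Uh|Uh] := eqVneq (U h) 0; last by rewrite ffunE (negbTE Uh) UX.
  have [Xh _|Xh _] := eqVneq (X h) 0; last by rewrite UB.
  by rewrite Xh eq_sym B0 Xh.
exists f; first by rewrite inE -/B UB.
rewrite inE bY !ffunE Uf eqxx UB //.
by case: (cov_cases covL f LX) Xf => ->.
Qed.

Theorem covectors_shellable : A != finset.set0 ->
  shellable (vert @` [set X | L X /\ exists2 e, e \in A & X e = 0]).
Proof.
case/set0Pn => e0 e0A; set K := (X in shellable X).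
have KX X e : L X -> e \in A -> X e = 0 -> K (vert X).
  by move=> LX eA Xe; exists X => //; split=> //; exists e.
have K_sc : simplicial_complex K.
  split.
  - apply: finite_image; apply: sub_finite_set (finite_covectors covL).
    by move=> X [].
  - by rewrite -vert_zero; apply: (KX _ e0) => //; [exact: cov_L0|rewrite ffunE].
  - move=> F G [X [LX [e eA Xe]] <-] GX.
    have [Y LY YG] := vert_sub LX GX; rewrite -YG; apply: (KX _ e) => //.
    by apply: (cov_face_zero _ Xe); apply/vert_face => //; rewrite YG.
have facetP F : facet K F <-> exists X e, [/\ e \in A, ridge e X & vert X = F].
  split.
    move=> [[X [LX [e eA Xe]] <-] Fmax].
    have [Y rY] := exists_ridge e.
    have [LXY XY0] := ridge_comp LX Xe rY.
    exists (cov_comp X Y), e; split=> //; apply: Fmax.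
      by apply: (KX _ e) => //; apply/eqP; rewrite XY0.
    by apply/vert_face => //; exact: cov_face_comp.
  move=> [X [e [eA rX <-]]]; have [LX X0] := rX; split.
    by apply: (KX _ e) => //; apply/eqP; rewrite X0.
  move=> _ [Y [LY [f fA Yf]] <-] /vert_face XY; congr vert.
  have {}XY := XY LX LY.
  have /eqP fe : f == e by rewrite -X0; apply/eqP; exact: cov_face_zero XY Yf.
  by apply: (ridge_maximal rX XY); rewrite -fe.
have [C cC] := exists_chamber; have [X0 rX0] := exists_ridge e0.
have cardX e X : ridge e X -> #|` vert X| = #|` vert X0|.
  by move=> rX; apply: succn_inj; rewrite -(card_ridge rX cC) -(card_ridge rX0 cC).
pose unvert F := xget (cov_zero E) [set X | L X /\ vert X = F].
have unvertK X : L X -> unvert (vert X) = X.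
  move=> LX; have [|LY YX] := @xgetPex _ (cov_zero E) [set Y | L Y /\ vert Y = vert X].
    by exists X.
  exact: vert_inj.
split=> //; exists #|` vert X0|; split.
  by move=> F /facetP [X [e [eA rX <-]]]; rewrite /face_dim (cardX _ _ rX).
pose le F G := (shelling_key (unvert F) <= shelling_key (unvert G))%N.
have le_tr : transitive le by move=> y x z; exact: leq_trans.
have le_tot : total le by move=> x y; exact: leq_total.
have Ffin : finite_set (facet K).
  by case: K_sc => Kfin _ _; apply: sub_finite_set Kfin => F [].
pose s := sort le (fset_set (facet K)).
have sP F : F \in s <-> facet K F.
  by rewrite mem_sort in_fset_set // inE.
have s_uniq : uniq s by rewrite sort_uniq fset_uniq.
have s_sorted : sorted le s by exact: sort_sorted.
(* Sortedness gives only a weak inequality of keys, so a strict one is needed to conclude that a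
   facet comes earlier. *)
have key_nth i j : (i < size s)%N -> (j < size s)%N ->
    (shelling_key (unvert (nth fset0 s i)) <
     shelling_key (unvert (nth fset0 s j)))%N -> (i < j)%N.
  move=> is_ js; apply: contraTT; rewrite -!leqNgt => ji.
  apply: (sorted_leq_nth le_tr _ fset0 s_sorted) => //.
  by move=> x; exact: leqnn.
exists s; split=> // j /andP[j0 js] G [[Gj [i /= ij Gi]] Gmax].
have is_ : (i < size s)%N := ltn_trans ij js.
have /sP/facetP [X [e [eA rX Xj]]] := mem_nth fset0 js.
have /sP/facetP [X' [e' [e'A rX' Xi]]] := mem_nth fset0 is_.
have LX : L X by case: rX.
have LX' : L X' by case: rX'.
have [W LW WG] : exists2 W, L W & vert W = G by apply: (vert_sub LX); rewrite Xj.
have [||||U [v [f [Y [LU WU [vX UXv] [fA rY] [UY lt]]]]]] :=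
    @shelling_step e e' X X' W eA e'A rX rX' _ _ LW.
- move=> eqX; move: Xi; rewrite eqX Xj => /eqP; rewrite nth_uniq // => /eqP ji.
  by move: ij; rewrite ji ltnn.
- rewrite leqNgt; apply/negP => lt.
  suff : (j < i)%N by rewrite ltnNge ltnW.
  by apply: key_nth => //; rewrite -Xi -Xj !unvertK.
- by apply/vert_face => //; rewrite WG Xj.
- by apply/vert_face => //; rewrite WG Xi.
have LY : L Y by case: rY.
have Ys : vert Y \in s by apply/sP/facetP; exists Y, f.
(* [U] lies in the facet numbered [j] and in the earlier facet [vert Y], so maximality of [G] gives
   equality. *)
have UG : vert U = G.
  apply: Gmax; last by rewrite -WG; apply/vert_face.
  split; first by rewrite /simplex /= -Xj UXv fsubD1set.
  exists (index (vert Y) s); last by rewrite /simplex /= nth_index //; apply/vert_face.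
  rewrite /=; apply: key_nth; rewrite ?index_mem // nth_index // -Xj !unvertK //.
rewrite /face_dim -UG -(cardX _ _ rX) (card_wall vX UXv).
by rewrite -addn1 PoszD -addrA.
Qed.

End SimplicialCovectors.

(** * Sign vectors of an arrangement *)

Lemma shellable_fset0 (T : choiceType) : shellable [set fset0 : {fset T}].
Proof.
have fct (F : {fset T}) : facet [set fset0] F <-> F = fset0.
  by split=> [[]|->] //; split=> // G ->.
split.
  split=> [|//|F G ->]; first exact: finite_set1.
  by rewrite fsubset0 => /eqP.
exists 0%N; split; first by move=> F /fct ->; rewrite /face_dim cardfs0.
exists [:: fset0]; split=> //.
- by move=> F; rewrite inE; split=> [/eqP ->|/fct ->].
- by case.
Qed.

Lemma sgz_pos_comb (R : realDomainType) (b c x y : R) : 0 < b -> 0 < c ->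
    ~~ ((sgz x != 0) && (sgz y == - sgz x)) ->
  sgz (b * x + c * y) = if sgz x == 0 then sgz y else sgz x.
Proof.
move=> b0 c0; case: (sgzP x) => [->|x0|x0]; case: (sgzP y) => [->|y0|y0] //= _;
  rewrite ?mulr0 ?addr0 ?add0r ?sgz0 //.
- by rewrite gtr0_sgz // mulr_gt0.
- by rewrite ltr0_sgz // pmulr_rlt0.
- by rewrite gtr0_sgz // mulr_gt0.
- by rewrite gtr0_sgz // addr_gt0 // mulr_gt0.
- by rewrite ltr0_sgz // pmulr_rlt0.
- by rewrite ltr0_sgz // -oppr_gt0 opprD addr_gt0 // oppr_gt0 pmulr_rlt0.
Qed.

Lemma sgz_dominated (R : realDomainType) (x y : R) : `|y| < `|x| ->
  sgz (x + y) = sgz x.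
Proof.
rewrite lter_norml => /andP[]; case: (sgzP x) => [->|x0|x0].
- by rewrite oppr0 => /lt_trans/[apply]; rewrite ltxx.
- by move=> yx _; rewrite gtr0_sgz // -ltrBlDl sub0r.
- by move=> _ yx; rewrite ltr0_sgz // -ltrBrDl sub0r.
Qed.

(** * Inner product and radial projection to the sphere *)

Section Dot.
Variables (R : realType) (n : nat).
Local Notation V := ('rV[R]_n).
Implicit Types u v p q : V.

Lemma dotDr u p q : dot u (p + q) = dot u p + dot u q.
Proof. by rewrite -big_split; apply: eq_bigr => i _; rewrite mxE mulrDr. Qed.

Lemma dotZr u c p : dot u (c *: p) = c * dot u p.
Proof. by rewrite mulr_sumr; apply: eq_bigr => i _; rewrite mxE mulrCA. Qed.

Lemma dotC u v : dot u v = dot v u.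
Proof. by apply: eq_bigr => i _; rewrite mulrC. Qed.

Lemma dot_ge0 p : 0 <= dot p p.
Proof. by apply: sumr_ge0 => i _; rewrite -expr2 sqr_ge0. Qed.

Lemma dot_eq0 p : (dot p p == 0) = (p == 0).
Proof.
apply/idP/eqP => [|->]; last by rewrite /dot big1 // => i _; rewrite mxE mul0r.
rewrite psumr_eq0 => [/allP p0|i _]; last by rewrite -expr2 sqr_ge0.
apply/rowP => i; rewrite mxE; have := p0 i; rewrite mem_index_enum => /(_ isT).
by rewrite -expr2 sqrf_eq0 => /eqP.
Qed.

Lemma dot_gt0 p : p != 0 -> 0 < dot p p.
Proof. by rewrite lt0r dot_ge0 andbT dot_eq0. Qed.

Lemma cvg_dot (T : Type) (F : set_system T) (f g : T -> V) p q : Filter F ->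
  f @ F --> p -> g @ F --> q -> dot (f x) (g x) @[x --> F] --> dot p q.
Proof.
move=> FF fp gq; rewrite /dot; apply: cvg_big => [|i _].
  exact: add_continuous.
apply: cvgM.
  exact: (cvg_comp _ _ fp (@coord_continuous _ _ _ ord0 i p)).
exact: (cvg_comp _ _ gq (@coord_continuous _ _ _ ord0 i q)).
Qed.

Definition normalize p : V := (Num.sqrt (dot p p))^-1 *: p.

Lemma sphere_normalize p : p != 0 -> sphere (normalize p).
Proof.
move=> p0; rewrite /sphere /normalize /= dotZr dotC dotZr mulrA -expr2.
by rewrite exprVn sqr_sqrtr ?dot_ge0 // mulVf // dot_eq0.
Qed.

Lemma sphere_neq0 p : sphere p -> p != 0.
Proof. by move=> pp; rewrite -dot_eq0 pp oner_eq0. Qed.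

End Dot.

(** * Sign vectors, cells and their vertices *)

Section ArrangementSigns.
Variables (R : realType) (n : nat) (H : {fset {vspace 'rV[R]_n}}).
Variable a : H -> 'rV[R]_n.
Local Notation V := ('rV[R]_n).
Implicit Types (p q v : V) (h g : H).

Lemma covectors_sign_vector : covectors (range (sign_vector a)).
Proof.
split.
- by move=> _ h [p _ <-]; rewrite ffunE sgz_id.
- exists 0 => //; apply/ffunP => h; rewrite !ffunE.
  by rewrite -[0 in LHS](scale0r 0) dotZr mul0r sgz0.
- move=> _ [p _ <-]; exists (- p) => //; apply/ffunP => h.
  by rewrite !ffunE -scaleN1r dotZr mulN1r sgzN.
- move=> _ _ [p _ <-] [q _ <-].
  (* [N] exceeds every quotient with nonzero denominator, so [N *: p] decides the sign wherever [p]
     is off the hyperplane; quotients with zero denominator count as 0. *)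
  pose N := 1 + \sum_h `|dot (a h) q| / `|dot (a h) p|.
  have N0 : 0 < N.
    by rewrite ltr_pwDl // sumr_ge0 // => h _; rewrite divr_ge0.
  exists (N *: p + q) => //; apply/ffunP => h; rewrite !ffunE dotDr dotZr sgz_eq0.
  have [->|p0] := eqVneq (dot (a h) p) 0; first by rewrite mulr0 add0r.
  rewrite sgz_dominated; first by rewrite sgzM gtr0_sgz // mul1r.
  rewrite normrM (gtr0_norm N0) -ltr_pdivrMr ?normr_gt0 // /N (bigD1 h) //=.
  rewrite addrCA ltrDl ltr_pwDl // sumr_ge0 // => g _; by rewrite divr_ge0.
- move=> _ _ h [p _ <-] [q _ <-]; rewrite inE !ffunE => /andP[ph qh].
  have ph0 : dot (a h) p != 0 by rewrite -sgz_eq0.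
  have qh0 : dot (a h) q != 0 by rewrite -sgz_eq0 (eqP qh) oppr_eq0.
  (* The weights are positive and cancel at [h], where the two values have opposite signs. *)
  exists (sign_vector a (`|dot (a h) q| *: p + `|dot (a h) p| *: q)).
  split; first by eexists.
    rewrite ffunE dotDr !dotZr; apply/eqP; rewrite sgz_eq0.
    move: ph0 qh0 qh; case: (sgzP (dot (a h) p)) => //; case: (sgzP (dot (a h) q)) => //.
      by move=> _ _ _ _ _; rewrite mulrC mulrN addNr.
    by move=> _ _ _ _ _; rewrite mulrC mulNr addrN.
  move=> g; rewrite inE !ffunE dotDr !dotZr => gpq.
  by rewrite sgz_pos_comb // normr_gt0.
Qed.

Lemma sign_vectorZ c p : 0 < c -> sign_vector a (c *: p) = sign_vector a p.
Proof. by move=> c0; apply/ffunP => h; rewrite !ffunE dotZr sgzM gtr0_sgz // mul1r. Qed.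

Lemma sign_vector_normalize p : p != 0 ->
  sign_vector a (normalize p) = sign_vector a p.
Proof.
move=> p0; apply: sign_vectorZ.
by rewrite invr_gt0 sqrtr_gt0 dot_gt0.
Qed.

Definition cell (X : {ffun H -> int}) : set V :=
  [set q | sphere q /\ sign_vector a q = X].

Lemma cell_id p : sphere p -> cell (sign_vector a p) p.
Proof. by []. Qed.

Lemma cells_cell p : sphere p -> cells a (cell (sign_vector a p)).
Proof. by exists p. Qed.

(** Strict sign conditions are open, so they pass from [v] to nearby points of the cell; conversely
    [v] is approached from the direction of [p]. *)
Lemma closure_cell v p : sphere v -> sphere p ->
  closure (cell (sign_vector a p)) v <->
  cov_face (sign_vector a v) (sign_vector a p).
Proof.
move=> Sv Sp; split.
  move=> clv h; rewrite ffunE => vh.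
  pose B := [set q | sgz (dot (a h) q) = sgz (dot (a h) v)].
  have [|q [[_ <-] Bq]] := clv B; last by rewrite ffunE.
  have hcvg : dot (a h) q @[q --> v] --> dot (a h) v.
    by apply: (@cvg_dot _ _ _ (nbhs v) (cst (a h)) id); [exact: cvg_cst|exact: cvg_id].
  move: vh; rewrite sgz_eq0 /B /mkset neq_lt => /orP[v0|v0].
    by apply: filterS (cvgr_lt _ hcvg _ v0) => q q0; rewrite !ltr0_sgz.
  by apply: filterS (cvgr_gt _ hcvg _ v0) => q q0; rewrite !gtr0_sgz.
move=> vp B nB.
(* No entry of [v] opposes that of [p], so [v + t *: p] has the sign vector of [p] for all [t > 0];
   normalizing returns it to the sphere. *)
pose f (t : R) := normalize (v + t *: p).
have vt : v + t *: p @[t --> 0^'+] --> v.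
  apply: cvg_at_right_filter.
  rewrite -[X in _ --> X](_ : v + 0 *: p = v); last by rewrite scale0r addr0.
  by apply: cvgD; [exact: cvg_cst|apply: cvgZr_tmp; exact: cvg_id].
have dvt : dot (v + t *: p) (v + t *: p) @[t --> 0^'+] --> dot v v.
  exact: cvg_dot.
have fcvg : f t @[t --> 0^'+] --> v.
  rewrite /f /normalize.
  rewrite -[X in _ --> X]scale1r; apply: cvgZ => //.
  rewrite -[X in _ --> X]invr1; apply: cvgV; first exact: oner_neq0.
  rewrite -[X in _ --> X]sqrtr1 -[X in Num.sqrt X]Sv.
  exact: (cvg_comp _ _ dvt (@sqrt_continuous _ _)).
near (0 : R)^'+ => t.
exists (f t); split; last by near: t; exact: fcvg.
have t0 : 0 < t by near: t; exact: nbhs_right_gt.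
have signt : sign_vector a (v + t *: p) = sign_vector a p.
  apply/ffunP => h; rewrite !ffunE dotDr dotZr -[X in X + _]mul1r.
  move: (vp h); rewrite !ffunE => vph.
  rewrite sgz_pos_comb //; first by case: eqVneq vph => // _ ->.
  apply/negP => /andP[v0 /eqP]; rewrite -vph // => /eqP.
  by rewrite -addr_eq0 -mulr2n mulrn_eq0 /= (negbTE v0).
have vt0 : v + t *: p != 0.
  rewrite -dot_eq0 gt_eqF //; near: t; apply: (cvgr_gt _ dvt).
  by rewrite Sv ltr01.
by split; [exact: sphere_normalize|rewrite sign_vector_normalize].
Unshelve. all: by end_near. Qed.

Hypothesis hcap : intersection H = 0%VS.
Hypothesis ha : is_orientation a.

Lemma sign_vector_zeroP p h : sign_vector a p h = 0 <-> p \in fsval h.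
Proof.
rewrite ffunE; split=> [/eqP|/ha ->]; last by rewrite sgz0.
by rewrite sgz_eq0 => /eqP/ha.
Qed.

Lemma sign_vector_eq0 p : sign_vector a p = cov_zero H -> p = 0.
Proof.
move=> p0; apply/eqP; rewrite -memv0 -hcap /intersection.
have pH (U : {vspace V}) : U \in H -> p \in U.
  by move=> UH; apply/(sign_vector_zeroP p [` UH]%fset); rewrite p0 ffunE.
rewrite big_seq; elim/big_ind: _ => [|U W pU pW|//]; first exact: memvf.
by rewrite memv_cap pU.
Qed.

Lemma sign_vector0 : sign_vector a 0 = cov_zero H.
Proof. by apply/ffunP => h; rewrite [RHS]ffunE; apply/sign_vector_zeroP; exact: mem0v. Qed.

Hypothesis hsimp : simplicial_arrangement a.

(** The zero covector is realized by no point of the sphere; its empty vertex set stands for the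
    empty face. *)
Definition cell_vertices (X : {ffun H -> int}) : {fset V} :=
  fset_set (vertex_set (cells a) (cell X)).

Lemma vertex_set_sphere C v : vertex_set (cells a) C v -> sphere v.
Proof.
move=> [[p Sp Cv] _]; have : [set v] v by [].
by rewrite Cv => -[].
Qed.

Lemma cell0 : cell (cov_zero H) = set0.
Proof.
apply/seteqP; split=> // p [Sp /sign_vector_eq0 p0].
by move: (sphere_neq0 Sp); rewrite p0 eqxx.
Qed.

Lemma sphere_sign_vector p : sign_vector a p <> cov_zero H ->
  exists2 q, sphere q & sign_vector a q = sign_vector a p.
Proof.
move=> pn0; have p0 : p != 0 by apply/eqP => p0; apply: pn0; rewrite p0 sign_vector0.
by exists (normalize p); [exact: sphere_normalize|exact: sign_vector_normalize].
Qed.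

Lemma cell_verticesE p : [set` cell_vertices (sign_vector a p)] =
  vertex_set (cells a) (cell (sign_vector a p)).
Proof.
apply: fset_setK; have [->|/eqP/sphere_sign_vector [q Sq <-]] :=
    eqVneq (sign_vector a p) (cov_zero H).
  rewrite cell0 [vertex_set _ _](_ : _ = set0) //.
  by apply/seteqP; split=> // v [_]; rewrite closure0.
by case: hsimp => fin _ _ _; case: (fin _ (cells_cell Sq)).
Qed.

Lemma cell_vertices0 : cell_vertices (cov_zero H) = fset0.
Proof.
rewrite /cell_vertices cell0 [vertex_set _ _](_ : _ = set0) ?fset_set0 //.
by apply/seteqP; split=> // v [_]; rewrite closure0.
Qed.

(** For nonzero covectors, simpliciality turns inclusion of vertex sets into the closure order, and
    [closure_cell] turns that into the face order. The zero covector has no cell and is treated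
    apart. *)
Lemma cell_vertices_face (X Y : {ffun H -> int}) :
    range (sign_vector a) X -> range (sign_vector a) Y ->
  (cell_vertices X `<=` cell_vertices Y)%fset <-> cov_face X Y.
Proof.
move=> [p _ <-] [q _ <-].
have subE : (cell_vertices (sign_vector a p) `<=` cell_vertices (sign_vector a q))%fset <->
    vertex_set (cells a) (cell (sign_vector a p)) `<=`
    vertex_set (cells a) (cell (sign_vector a q)).
  rewrite -!cell_verticesE; split=> [/fsubsetP//|sub].
  exact/fsubsetP.
rewrite {}subE; have [hfin hle _ _] := hsimp.
have [p0|/eqP/sphere_sign_vector [p' Sp <-]] :=
    eqVneq (sign_vector a p) (cov_zero H).
  rewrite p0; split=> _; first exact: cov_face0.
  by rewrite cell0 => v [_]; rewrite closure0.
have Cp := cells_cell Sp.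
have [q0|/eqP/sphere_sign_vector [q' Sq <-]] :=
    eqVneq (sign_vector a q) (cov_zero H).
  rewrite q0; split.
    have [_ [v pv]] := hfin _ Cp.
    by move=> /(_ v pv) [_]; rewrite cell0 closure0.
  move=> face; have : sign_vector a p' = cov_zero H.
    by apply: cov_face_anti => //; exact: cov_face0.
  by move/sign_vector_eq0/eqP; rewrite (negbTE (sphere_neq0 Sp)).
have Cq := cells_cell Sq; split=> [/(hle _ _ Cp Cq) sub|face v vp].
  by apply/closure_cell => //; exact/sub/cell_id.
have Sv := vertex_set_sphere vp; case: vp => Pv /closure_cell vp; split=> //.
by apply/closure_cell => //; apply: cov_face_trans face; exact: vp.
Qed.

Lemma cell_vertices_sub (X : {ffun H -> int}) (S : {fset V}) :
    range (sign_vector a) X -> (S `<=` cell_vertices X)%fset ->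
  exists2 Y, range (sign_vector a) Y & cell_vertices Y = S.
Proof.
move=> [p _ <-] Sp.
have [->|Sn0] := eqVneq S fset0.
  exists (cov_zero H); last exact: cell_vertices0.
  by exists 0 => //; exact: sign_vector0.
have pn0 : sign_vector a p <> cov_zero H.
  by move=> p0; move: Sp Sn0; rewrite p0 cell_vertices0 fsubset0 => ->.
have [q Sq qp] := sphere_sign_vector pn0.
have [_ _ _ [_ _ down]] := hsimp.
have [|S0|[_ [r Sr ->] SC]] := down (cell_vertices (sign_vector a p)) S _ Sp.
- right; exists (cell (sign_vector a p)); last exact: cell_verticesE.
  by rewrite -qp; exact: cells_cell.
- by rewrite S0 eqxx in Sn0.
- exists (sign_vector a r) => //; rewrite /cell_vertices.
  by rewrite -/(cell _) in SC; rewrite -SC set_fsetK.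
Qed.

(** A cell lies in the union of [A] as soon as one of its points does, since all points of a cell
    lie on the same hyperplanes. *)
Lemma Delta_cell_vertices (A : {fset {vspace V}}) : (A `<=` H)%fset -> A != fset0 ->
  Delta A a = cell_vertices @` [set X | range (sign_vector a) X /\
    exists2 h, h \in [set h : H | fsval h \in A]%SET & X h = 0].
Proof.
move=> AH An0.
have inA p : (exists2 h : H, h \in [set h : H | fsval h \in A]%SET &
    sign_vector a p h = 0) <-> union_of A p.
  split=> [[h]|[U UA pU]].
    by rewrite inE => hA /sign_vector_zeroP ph; exists (fsval h).
  exists [` fsubsetP AH U UA]%fset; first by rewrite inE.
  exact/sign_vector_zeroP.
have cellA p : sphere p -> union_of A p -> cell (sign_vector a p) `<=` union_of A.
  by move=> Sp /inA [h hA ph] q [Sq qp]; apply/inA; exists h; rewrite ?qp.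
(* A vertex of a cell is below it in the face order, hence on the same hyperplane of [A];
   restricting to the subcomplex loses no vertices. *)
have vertA p : sphere p -> union_of A p ->
    vertex_set [set C | cells a C /\ C `<=` union_of A] (cell (sign_vector a p)) =
    vertex_set (cells a) (cell (sign_vector a p)).
  move=> Sp pA; apply/seteqP; split=> v; first by move=> [[? _] ?].
  move=> vp; have Sv := vertex_set_sphere vp; case: vp => Cv vp.
  split=> //; split=> // _ ->; apply/inA.
  have /inA [h hA ph] := pA; exists h => //.
  by apply: cov_face_zero ph; exact/closure_cell.
apply/seteqP; split=> F.
  case=> [->|[_ [[p Sp ->] pA] Fp]].
    exists (cov_zero H); last exact: cell_vertices0.
    split; first by exists 0 => //; exact: sign_vector0.
    have /fset0Pn [U UA] := An0.
    by exists [` fsubsetP AH U UA]%fset; rewrite ?inE // ffunE.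
  have {}pA : union_of A p by exact/pA/cell_id.
  exists (sign_vector a p); first by split; [exists p|exact/inA].
  by rewrite /cell_vertices -vertA // -[F]set_fsetK Fp.
move=> [_ [[p _ <-] pA] <-].
have [p0|/eqP/sphere_sign_vector [q Sq qp]] := eqVneq (sign_vector a p) (cov_zero H).
  by left; rewrite p0 cell_vertices0.
rewrite -qp in pA *; have {}pA := (inA q).1 pA.
right; exists (cell (sign_vector a q)).
  by split; [exact: cells_cell|exact: cellA].
by rewrite vertA // cell_verticesE.
Qed.

End ArrangementSigns.

(** * Reduction of the geometric statement to covectors *)

Lemma hyperplane_proper (R : realType) (n : nat) (U : {vspace 'rV[R]_n}) :
  is_hyperplane U -> U <> fullv.
Proof.
move=> dU Uf; move: dU; rewrite /is_hyperplane Uf dimvf dim_matrix.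
by rewrite [(_ * n)%R]mul1n => /esym/n_Sn.
Qed.

(** Being proper, [U] is the intersection of a nonempty family, so it lies in some member of [H] and
    equals it by dimension. *)
Lemma embedded_hyperplanes_sub (R : realType) (n : nat)
    (H A : {fset {vspace 'rV[R]_n}}) :
  hyperplane_arrangement H -> embedded A H ->
  (forall U, U \in A -> is_hyperplane U) -> (A `<=` H)%fset.
Proof.
move=> hH [AL _] hhyp; apply/fsubsetP => U UA.
have dU := hhyp U UA; have [S SH US] := AL U UA.
have [S0|/fset0Pn [h hS]] := eqVneq S fset0.
  by case: (hyperplane_proper dU); rewrite US S0 /intersection big_seq_fset0.
have hHh := fsubsetP SH h hS; suff -> : U = h by [].
apply/eqP; rewrite eqEdim; apply/andP; split.
  by rewrite US /intersection (big_fsetD1 h) //= capvSl.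
by rewrite -ltnS dU (hH h hHh).
Qed.

Theorem theorem4p2 (R : realType) (n : nat)
    (H A : {fset {vspace 'rV[R]_n}}) (a : H -> 'rV[R]_n)
    (hH : hyperplane_arrangement H)
    (ha : is_orientation a)
    (hcap : intersection H = 0%VS)
    (hsimp : simplicial_arrangement a)
    (hA : subspace_arrangement A)
    (hemb : embedded A H)
    (hhyp : forall U, U \in A -> is_hyperplane U) :
  shellable (Delta A a).
Proof.
have AH := embedded_hyperplanes_sub hH hemb hhyp.
(* For empty [A] the union is empty, and since cells are nonempty only the empty face remains. *)
have [A0|An0] := eqVneq A fset0.
  rewrite (_ : Delta A a = [set fset0]); first exact: shellable_fset0.
  apply/seteqP; split=> [F|_ ->]; last by left.
  case=> [//|[_ [[p Sp ->] pA] _]].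
  by have [|U] := pA p; rewrite // A0 inE.
rewrite Delta_cell_vertices //; apply: covectors_shellable.
- exact: covectors_sign_vector.
- exact: cell_vertices_face.
- exact: cell_vertices_sub.
(* The normal vector is off its hyperplane: otherwise it would be zero and the hyperplane the whole
   space. *)
- move=> h; exists (sign_vector a (a h)); first by exists (a h).
  apply/eqP => /(sign_vector_zeroP ha) /ha /eqP; rewrite dot_eq0 => /eqP ah0.
  apply: (hyperplane_proper (hH _ (fsvalP h))).
  apply/eqP; rewrite eqEsubv subvf /=; apply/subvP => x _; apply/ha.
  by rewrite ah0 dotC -(scale0r 0) dotZr mul0r.
- move=> h g hg; have /subvPn [x xh xg] : ~~ (fsval h <= fsval g)%VS.
    apply: contra hg => hg; apply/eqP/val_inj/eqP; rewrite eqEdim hg /=.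
    by rewrite -ltnS (hH _ (fsvalP h)) (hH _ (fsvalP g)).
  exists (sign_vector a x); split; first by exists x.
    exact/(sign_vector_zeroP ha).
  by apply: contraNneq xg => /(sign_vector_zeroP ha).
- have /fset0Pn [U UA] := An0; apply/set0Pn.
  by exists [` fsubsetP AH U UA]%fset; rewrite inE.
Qed.
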